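(* For every integer $n\ge 6$, $diss(K_{n,3})=\alpha(K_{n,3})$ if and only if $n\ge 8$.
   Context: For positive integers $n,k$ with $n\ge 2k$, the Kneser graph $K_{n,k}$ has as vertices all $k$-element subsets of $[n]=\{1,\dots,n\}$, two of them being adjacent if and only if they are disjoint. A set $D$ of vertices of a graph $G$ is a dissociation set if the subgraph of $G$ induced by $D$ has maximum degree at most $1$. The dissociation number $diss(G)$ is the maximum cardinality of a dissociation set in $G$, and $\alpha(G)$ is the independence number of $G$, i.e. the maximum cardinality of a set of pairwise non-adjacent vertices. *)

(* Defs.v *)
From mathcomp Require Import all_boot.

Set Implicit Arguments.
Unset Strict Implicit.
Unset Printing Implicit Defensive.

(* A finite simple graph is a symmetric irreflexive relation e on a finType. *)

Definition max_degree (T : finType) (e : rel T) : nat :=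
  \max_(x : T) #|[set y | e x y]|.

Definition induced (T : finType) (e : rel T) (D : {set T}) :
    rel {x : T | x \in D} :=
  fun x y => e (val x) (val y).

Definition dissociation_set (T : finType) (e : rel T) (D : {set T}) : bool :=
  max_degree (induced e (D := D)) <= 1.

Definition diss (T : finType) (e : rel T) : nat :=
  \max_(D : {set T} | dissociation_set e D) #|D|.

Definition independent_set (T : finType) (e : rel T) (S : {set T}) : bool :=
  [forall x in S, forall y in S, (x != y) ==> ~~ e x y].

Definition alpha (T : finType) (e : rel T) : nat :=
  \max_(S : {set T} | independent_set e S) #|S|.

(* The ground set [n] is 'I_n = {0, ..., n-1}. *)
Definition kneser_vertex (n k : nat) : finType :=
  {A : {set 'I_n} | #|A| == k}.

Definition kneser (n k : nat) : rel (kneser_vertex n k) :=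
  fun A B => [disjoint val A & val B].
Arguments kneser : clear implicits.

Lemma kneser_sym (n k : nat) : symmetric (kneser n k).
Proof. by move=> A B; rewrite /kneser disjoint_sym. Qed.

(* This fails for k = 0, where the empty set is disjoint from itself. *)
Lemma kneser_irrefl (n k : nat) : 0 < k -> irreflexive (kneser n k).
Proof.
move=> k_gt0 A; rewrite /kneser -setI_eq0 setIid -cards_eq0.
by rewrite (eqP (valP A)) eqn0Ngt k_gt0.
Qed.

(* Main.v *)
Require Import Defs.
From mathcomp Require Import all_boot.
From mathcomp Require Import ssralg zmodp fingroup perm action.
From mathcomp Require Import primitive_action alt zify.

Set Implicit Arguments.
Unset Strict Implicit.
Unset Printing Implicit Defensive.

(** If n >= 8, the 3-subsets containing a fixed point are pairwise intersecting,
    so that diss >= alpha >= C(n-1, 2), and everything rests on the bound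
    |F| <= C(n-1, 2) for a family F of 3-sets in which each member is disjoint
    from at most one other member ([card_dissociated]).

    If no two members of F are disjoint this is the Erdos-Ko-Rado theorem
    ([erdos_ko_rado]), proved by Katona's circle: among the arcs of length k of
    a circle of n >= 2k points at most k meet pairwise ([card_meeting_arcs]),
    and averaging over all the ways to place the points on the circle
    ([averaging_bound]) turns this into a bound on F.

    Otherwise fix disjoint A and B in F. Every other member C must meet both:
    if C missed A, then A would be disjoint from both B and C. So either C lies
    in A u B and arises from A or B by exchanging one point with a point of the
    other set, or C = {a, b, z} with a in A, b in B and z outside A u B.
    Let I count the members b + (A - a), J the members a + (B - b), and G the
    members {a, b, z}, and let p = n - 6 be the number of choices of z.
    - A member b + (A - a) is disjoint from a + (B - b) and from the 2p triples
      {a, c, z} with c <> b, and at most one of these can be in F. Adding this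
      up over all a and b gives 2p I + J + 2G <= 9 (2p + 1), and the same with
      I and J exchanged ([mixed_bound]).
    - For two points x <> y outside A u B, the pairs (a, b) completed by x and
      those completed by y are two subsets of a 3 x 3 grid, and a cell of one
      sees at most one cell of the other in a different row and column. Hence
      there are at most 9 cells in total ([slices_bound]), and averaging over x
      and y gives 2G <= 9p ([crossing_bound]).
    These inequalities imply 2 + I + J + G <= C(p + 5, 2) for p >= 2.

    If n is 6 or 7, then alpha <= C(n-1, 2) <= 15 by Erdos-Ko-Rado, while the 20
    triples inside a set of 6 points form a dissociation set, since such a
    triple is disjoint only from its complement ([diss_ge]). *)

(** * Averaging over permutations *)

Lemma perm_imset_onto (T : finType) (S X : {set T}) :
  #|S| = #|X| -> exists t : {perm T}, t @: S = X.
Proof.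
move=> eqSX.
have ntr := ntransitive_weak (max_card (mem S)) (Sym_trans T).
have szX : size (enum X) == #|S| by rewrite -cardE eqSX.
have szS : size (enum S) == #|S| by rewrite -cardE.
have dS : Tuple szS \in #|S|.-dtuple([set: T]).
  by rewrite inE enum_uniq /=; apply/subsetP=> x; rewrite inE.
have dX : Tuple szX \in #|S|.-dtuple([set: T]).
  by rewrite inE enum_uniq /=; apply/subsetP=> x; rewrite inE.
have [t _ /(congr1 val) /= eXt] := atransP2 ntr dS dX.
exists t; apply/setP=> x.
rewrite -(mem_enum X) eXt; apply/imsetP/mapP=> -[y yS ->]; exists y => //.
  by rewrite mem_enum.
by rewrite -mem_enum.
Qed.

Lemma card_perm_imset (T : finType) (S X : {set T}) : #|S| = #|X| ->
  #|[set s : {perm T} | s @: S == X]| = #|[set s : {perm T} | s @: S == S]|.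
Proof.
case/perm_imset_onto=> t <-.
rewrite -[RHS](card_imset _ (mulIg t)); apply: eq_card => s.
have act (u v : {perm T}) : (u * v)%g @: S = v @: (u @: S).
  by rewrite -imset_comp; apply: eq_imset => x /=; rewrite permM.
apply/idP/imsetP => [|[u + ->]]; rewrite inE => /eqP uS; last first.
  by rewrite inE act uS.
exists (s * t^-1)%g; last by rewrite mulgKV.
rewrite inE act uS -imset_comp; apply/eqP.
by rewrite -[RHS]imset_id; apply: eq_imset => x /=; rewrite permK.
Qed.

(** The image of S under a uniformly random permutation is a uniformly random
    k-set; here with the denominators cleared. *)
Lemma card_perm_into (T : finType) k (F : {set {set T}}) (S : {set T}) :
    #|S| = k -> {in F, forall X : {set T}, #|X| = k} ->
  #|[set s : {perm T} | s @: S \in F]| * 'C(#|T|, k) = #|F| * #|T|`!.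
Proof.
pose N := #|[set s : {perm T} | s @: S == S]|.
have into (G : {set {set T}}) : #|S| = k -> {in G, forall X : {set T}, #|X| = k} ->
    #|[set s : {perm T} | s @: S \in G]| = #|G| * N.
  move=> cS cG.
  rewrite -sum1dep_card (partition_big (fun s : {perm T} => s @: S) (mem G)) //=.
  rewrite -sum_nat_const; apply: eq_bigr => X XG.
  rewrite -[N](card_perm_imset (X := X)) ?cS ?cG // -sum1dep_card.
  by apply: eq_bigl => s; case: eqP => [->|]; rewrite ?XG ?andbT ?andbF.
move=> cS cF; rewrite (into F) // -mulnA; congr (_ * _).
have cD : {in [set X : {set T} | #|X| == k], forall X : {set T}, #|X| = k}.
  by move=> X; rewrite inE => /eqP.
rewrite -(card_Sym T) mulnC -card_draws -(into _ cS cD).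
by apply: eq_card => s; rewrite !inE card_imset ?cS ?eqxx //; apply: perm_inj.
Qed.

(** If no permuted copy of the configuration S_j contains more than c members
    of F, then F has density at most c / |J| among the k-sets, because the
    expected number of members in a random copy is |J| times that density. *)
Lemma averaging_bound (T J : finType) k c (F : {set {set T}}) (S : J -> {set T}) :
    (forall j, #|S j| = k) -> {in F, forall X : {set T}, #|X| = k} ->
    (forall s : {perm T}, #|[set j | s @: S j \in F]| <= c) ->
  #|J| * #|F| <= c * 'C(#|T|, k).
Proof.
move=> cS cF bound.
have total : #|J| * #|F| * #|T|`! =
    (\sum_j #|[set s : {perm T} | s @: S j \in F]|) * 'C(#|T|, k).
  rewrite -mulnA -[LHS]sum_nat_const big_distrl /=.
  by apply: eq_big => // j _; rewrite (card_perm_into (cS j) cF).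
rewrite -(leq_pmul2r (fact_gt0 #|T|)) total mulnAC leq_mul2r; apply/orP; right.
have -> : c * #|T|`! = \sum_(s : {perm T}) c.
  by rewrite sum_nat_const -(card_Sym T) cardsT mulnC.
under eq_bigr do rewrite -sum1dep_card big_mkcond /=.
rewrite exchange_big /=; apply: leq_sum => s _.
by rewrite -big_mkcond sum1dep_card.
Qed.

(** * Katona's circle and the Erdos-Ko-Rado theorem *)

Definition arc m k (i : 'I_m.+1) : {set 'I_m.+1} :=
  [set (i + inZp (d : 'I_k))%R | d : 'I_k].

Lemma card_arc m k (i : 'I_m.+1) : k <= m.+1 -> #|arc k i| = k.
Proof.
move=> le_k; rewrite card_imset ?card_ord // => d d' /GRing.addrI /(congr1 val) /= e.
have := ltn_ord d; have := ltn_ord d' => d'k dk.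
by apply: ord_inj; move: e; rewrite !modn_small; lia.
Qed.

Lemma inZpD m a b : (inZp a + inZp b = inZp (a + b) :> 'I_m.+1)%R.
Proof. by apply: val_inj; rewrite /= modnDm. Qed.

Lemma disjoint_arc m k (i : 'I_m.+1) :
  2 * k <= m.+1 -> [disjoint arc k i & arc k (i + inZp k)%R].
Proof.
move=> le_2k; rewrite -setI_eq0; apply/eqP/setP=> x; rewrite !inE.
apply/negP=> /andP[/imsetP[d _ ->] /imsetP[d' _]].
rewrite -GRing.addrA inZpD => /GRing.addrI /(congr1 val) /=.
have := ltn_ord d; have := ltn_ord d' => d'k dk.
by rewrite !modn_small; lia.
Qed.

(** Relative to a fixed arc i of the family, every start point j has an
    offset j - i + k between 1 and 2k - 1. Two offsets that agree modulo k are
    equal or differ by k, and in the latter case the two arcs are adjacent on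
    the circle, hence disjoint. So the offsets are distinct modulo k. *)
Lemma card_meeting_arcs m k (I : {set 'I_m.+1}) : 2 * k <= m.+1 ->
  {in I &, forall i j, ~~ [disjoint arc k i & arc k j]} -> #|I| <= k.
Proof.
move=> le_2k meetI.
have [->|/set0Pn[i iI]] := eqVneq I set0; first by rewrite cards0.
pose off j : nat := (j - i + inZp k)%R.
have offP j : j \in I -> 0 < off j < 2 * k.
  move=> jI; have := meetI _ _ iI jI.
  rewrite -setI_eq0 => /set0Pn[x /setIP[/imsetP[d _ ->] /imsetP[d' _ eq_ij]]].
  have := ltn_ord d; have := ltn_ord d' => d'k dk.
  have -> : off j = d + k - d'; last by lia.
  rewrite /off; have -> : (j - i + inZp k)%R = inZp (d + k - d') :> 'I_m.+1.
    apply: (GRing.addIr (inZp d')); rewrite inZpD subnK; last by lia.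
    rewrite GRing.addrAC (GRing.addrAC j) -eq_ij -inZpD.
    by rewrite (GRing.addrC i) GRing.addrK.
  by rewrite /= modn_small; lia.
have k_gt0 : 0 < k by have := offP _ iI; lia.
have off_inj : {in I &, forall j j', off j = off j' %[mod k] -> j = j'}.
  suff le_case j j' : j \in I -> j' \in I -> off j <= off j' ->
      off j = off j' %[mod k] -> j = j'.
    move=> j j' jI j'I e.
    have [le|/ltnW le] := leqP (off j) (off j'); first exact: le_case.
    by apply/esym/le_case.
  move=> jI j'I le_off /esym/eqP; rewrite eqn_mod_dvd // => dvd.
  have := offP _ jI; have := offP _ j'I.
  case/dvdnP: dvd => -[|[|q]] e b1 b2; last by lia.
    have /val_inj/GRing.addIr/GRing.addIr : off j = off j' by lia.
    by [].
  case/negP: (meetI _ _ jI j'I).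
  suff -> : j' = (j + inZp k)%R by apply: disjoint_arc.
  apply: (GRing.addIr (- i)%R); apply: (GRing.addIr (inZp k)); apply: ord_inj.
  have -> : (j + inZp k - i + inZp k)%R = inZp (off j + k) :> 'I_m.+1.
    by rewrite -inZpD /off valZpK (GRing.addrAC j).
  by rewrite -[LHS]/(off j') [RHS]/= modn_small; lia.
have mod_inj : {in I &, injective (fun j => Ordinal (ltn_pmod (off j) k_gt0))}.
  by move=> j j' jI j'I /(congr1 val) /= /off_inj; apply.
by rewrite -(card_in_imset mod_inj) -[leqRHS](card_ord k) max_card.
Qed.

Theorem erdos_ko_rado n k (F : {set {set 'I_n}}) :
    0 < k -> 2 * k <= n -> {in F, forall X : {set 'I_n}, #|X| = k} ->
    {in F &, forall X Y : {set 'I_n}, ~~ [disjoint X & Y]} ->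
  #|F| <= 'C(n.-1, k.-1).
Proof.
case: n F => [|m] F; first by lia.
move=> k_gt0 le_2k cF meetF.
rewrite -(leq_pmul2l (ltn0Sn m)) mul_bin_diag prednK //.
have := @averaging_bound _ _ k k F (@arc m k); rewrite !card_ord; apply=> // [j|s].
  by rewrite card_arc; lia.
apply: card_meeting_arcs => // i j; rewrite !inE => iF jF.
apply: contra (meetF _ _ iF jF) => dis.
rewrite -setI_eq0 -imsetI; last by move=> ? ? _ _; apply: perm_inj.
by move: dis; rewrite -setI_eq0 => /eqP->; rewrite imset0.
Qed.

(** * Dissociated families of triples with a disjoint pair *)

Lemma sum_bool_le1 (I : finType) (P f : pred I) :
    (forall i j, P i -> P j -> f i -> f j -> i = j) ->
  \sum_(i | P i) f i <= 1.
Proof.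
move=> f1; have -> : \sum_(i | P i) f i = #|[set i | P i && f i]|.
  by rewrite -sum1dep_card big_mkcondr; apply: eq_bigr => i _; case: (f i).
apply/card_le1_eqP => i j; rewrite !inE => /andP[Pi fi] /andP[Pj fj].
exact: f1.
Qed.

Lemma card_covered (I U : finType) (P : pred I) (f : I -> U) (F : {set U}) :
  #|F :&: [set f i | i in P]| <= \sum_(i | P i) (f i \in F).
Proof.
have -> : \sum_(i | P i) (f i \in F) = #|[set i | P i && (f i \in F)]|.
  by rewrite -sum1dep_card big_mkcondr; apply: eq_bigr => i _; case: (f i \in F).
apply: leq_trans (leq_imset_card f _); apply/subset_leq_card/subsetP=> X.
by case/setIP=> XF /imsetP[i Pi eX]; rewrite eX imset_f // inE -eX XF andbT.
Qed.

Definition dissociated (T : finType) (F : {set {set T}}) : Prop :=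
  forall C X Y, C \in F -> X \in F -> Y \in F ->
    [disjoint C & X] -> [disjoint C & Y] -> X = Y.

(** The counting behind [slices_bound]: g_i and h_i are the numbers of cells in
    row i of two subsets of a 3 x 3 grid. A cell of one subset sees all the
    cells of the other in a different row, except at most one per row (the one
    in its own column), which explains the predecessors in the hypotheses. *)
Lemma cross_rows_le9 g0 g1 g2 h0 h1 h2 :
    g0 <= 3 -> g1 <= 3 -> g2 <= 3 -> h0 <= 3 -> h1 <= 3 -> h2 <= 3 ->
    [/\ 0 < g0 -> h1.-1 + h2.-1 <= 1, 0 < g1 -> h0.-1 + h2.-1 <= 1 &
        0 < g2 -> h0.-1 + h1.-1 <= 1] ->
    [/\ 0 < h0 -> g1.-1 + g2.-1 <= 1, 0 < h1 -> g0.-1 + g2.-1 <= 1 &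
        0 < h2 -> g0.-1 + g1.-1 <= 1] ->
  g0 + g1 + g2 + (h0 + h1 + h2) <= 9.
Proof.
move: g0 g1 g2 h0 h1 h2 => [|g0] [|g1] [|g2] [|h0] [|h1] [|h2].
all: move=> ? ? ? ? ? ? [? ? ?] [? ? ?]; lia.
Qed.

Section Triples.
Variable T : finType.
Implicit Types (A B C : {set T}) (F : {set {set T}}).

Lemma disjointsU1 x A B :
  [disjoint x |: A & B] = (x \notin B) && [disjoint A & B].
Proof. by rewrite -!setI_eq0 setIUl setU_eq0 !setI_eq0 disjoints1. Qed.

Lemma disjoint_triple C z a b :
  [disjoint C & z |: [set a; b]] = [&& z \notin C, a \notin C & b \notin C].
Proof. by rewrite disjoint_sym !disjointsU1 disjoints1. Qed.

(** A triple with one point in A, one in B and one outside determines each of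
    these points, so that families of such triples can be counted by index. *)
Lemma triple_inj A B z z' a a' b b' : [disjoint A & B] ->
    z \notin A :|: B -> z' \notin A :|: B ->
    a \in A -> a' \in A -> b \in B -> b' \in B ->
  z |: [set a; b] = z' |: [set a'; b'] -> [/\ z = z', a = a' & b = b'].
Proof.
rewrite !inE !negb_or => dAB /andP[zA zB] /andP[z'A z'B] aA a'A bB b'B e.
have AB x y : x \in A -> y \in B -> (x == y) = false.
  by move=> xA yB; apply: contraTF yB => /eqP <-; rewrite (disjointFr dAB).
have Z x y (S : {set T}) : x \notin S -> y \in S -> (x == y) = false.
  by move=> xS; apply: contraTF => /eqP <-.
have [e1 e2 e3] : [/\ z \in z' |: [set a'; b'], a \in z' |: [set a'; b'] &
    b \in z' |: [set a'; b']] by rewrite -e !inE !eqxx !orbT.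
move: e1 e2 e3; rewrite !inE (Z z a' A) // (Z z b' B) // ![_ == z']eq_sym.
rewrite (Z z' a A) // (Z z' b B) // (AB a b') // [b == a']eq_sym (AB a' b) //.
by rewrite orbF /= !orbF => /eqP-> /eqP-> /eqP->.
Qed.

Definition mixed F A B : nat := \sum_(a in A) \sum_(b in B) (b |: (A :\ a) \in F).

Definition slice F A B z : nat :=
  \sum_(a in A) \sum_(b in B) (z |: [set a; b] \in F).

Definition crossing F A B : nat := \sum_(z in ~: (A :|: B)) slice F A B z.

Lemma crossingC F A B : crossing F A B = crossing F B A.
Proof.
rewrite /crossing setUC; apply: eq_bigr => z _; rewrite /slice exchange_big /=.
by apply: eq_bigr => b _; apply: eq_bigr => a _; rewrite (setUC [set a]).
Qed.

(** Double counting of the ordered pairs of distinct elements of S. *)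
Lemma sum_others (S : {set T}) (f : T -> nat) :
  \sum_(b in S) \sum_(c in S | c != b) f c = #|S|.-1 * \sum_(b in S) f b.
Proof.
rewrite (exchange_big_dep (mem S)) /=; last by move=> b c _ /andP[].
rewrite big_distrr; apply: eq_bigr => c cS /=.
rewrite (eq_bigl (mem (S :\ c))) => [|b]; last by rewrite !inE eq_sym cS andbC.
by rewrite sum_nat_const [#|S|](cardsD1 c) cS.
Qed.

(** A member other than A and B meets both of them, so it is {z, a, b} with a
    in A and b in B, and the three terms correspond to z in A, z in B and z
    elsewhere. *)
Lemma card_le_mixed_crossing F A B :
    {in F, forall X : {set T}, #|X| = 3} -> dissociated F ->
    A \in F -> B \in F -> [disjoint A & B] ->
  #|F| <= 2 + mixed F A B + mixed F B A + crossing F A B.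
Proof.
move=> cF dF AF BF dAB.
pose M1 := F :&: [set i.2 |: (A :\ i.1) |
  i in [pred i | (i.1 \in A) && (i.2 \in B)]].
pose M2 := F :&: [set i.2 |: (B :\ i.1) |
  i in [pred i | (i.1 \in B) && (i.2 \in A)]].
pose M3 := F :&: [set i.1 |: [set i.2.1; i.2.2] |
  i in [pred i | (i.1 \in ~: (A :|: B)) && ((i.2.1 \in A) && (i.2.2 \in B))]].
have sF : F \subset [set A; B] :|: M1 :|: M2 :|: M3.
  apply/subsetP=> C CF; rewrite !in_setU.
  have [<-|neCA] := eqVneq C A; first by rewrite set11.
  have [<-|neCB] := eqVneq C B; first by rewrite set11 orbT.
  have meets A' B' : A' \in F -> B' \in F -> [disjoint A' & B'] -> C != B' ->
      exists a, a \in C :&: A'.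
    move=> A'F B'F dAB' neC; apply/set0Pn; rewrite setI_eq0; apply: contraNN neC.
    by rewrite disjoint_sym => dAC; rewrite (dF A' C B').
  have [a /setIP[aC aA]] := meets _ _ AF BF dAB neCB.
  have dBA : [disjoint B & A] by rewrite disjoint_sym.
  have [b /setIP[bC bB]] := meets _ _ BF AF dBA neCA.
  have ab : a != b by apply: contraTneq aA => ->; rewrite (disjointFl dAB).
  have [z defC] : exists z, C :\ a :\ b = [set z].
    apply/cards1P; rewrite -2!eqSS -(cF _ CF) [#|C|](cardsD1 a) aC.
    by rewrite (cardsD1 b (C :\ a)) !inE (eq_sym b) ab bC.
  have /and3P[zb za zC] : [&& z != b, z != a & z \in C].
    by rewrite -!in_setD1 defC set11.
  have {}defC : C = z |: [set a; b].
    have bCa : b \in C :\ a by rewrite !inE eq_sym ab.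
    by rewrite -[LHS](setD1K aC) -(setD1K bCa) defC (setUC [set b]) setUCA.
  (* When z and u are two of the points of S, the removed point w is the third. *)
  have swap S u v : S \in F -> u \in S -> z \in S -> z != u -> C = v |: [set u; z] ->
      exists2 w, w \in S & C = v |: (S :\ w).
    move=> SF uS zS zu ->.
    have [w defw] : exists w, S :\ u :\ z = [set w].
      apply/cards1P; rewrite -2!eqSS -(cF _ SF) [#|S|](cardsD1 u) uS.
      by rewrite (cardsD1 z (S :\ u)) !inE zu zS.
    have /and3P[wz wu wS] : [&& w != z, w != u & w \in S].
      by rewrite -!in_setD1 defw set11.
    exists w => //; congr (_ |: _).
    apply/setP=> t; have /setP/(_ t) := defw; rewrite !inE.
    have [->|tu] := eqVneq t u; first by rewrite (eq_sym u w) wu uS.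
    have [->|tz] := eqVneq t z; first by rewrite (eq_sym z w) wz zS orbT.
    by move=> /= ->; case: eqP.
  have [zA|zA] := boolP (z \in A).
    have [|w wA eC] := swap A a b AF aA zA za.
      by rewrite defC (setUC [set a] [set b]) setUCA (setUC [set z]).
    suff -> : C \in M1 by rewrite !orbT.
    by rewrite inE CF /=; apply/imsetP; exists (w, b); rewrite // inE wA.
  have [zB|zB] := boolP (z \in B).
    have [|w wB eC] := swap B b a BF bB zB zb.
      by rewrite defC setUCA (setUC [set z]).
    suff -> : C \in M2 by rewrite !orbT.
    by rewrite inE CF /=; apply/imsetP; exists (w, a); rewrite // inE wB.
  suff -> : C \in M3 by rewrite !orbT.
  rewrite inE CF /=; apply/imsetP; exists (z, (a, b)); rewrite // !inE /= aA bB.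
  by rewrite negb_or zA zB.
have cM1 : #|M1| <= mixed F A B.
  by rewrite /mixed pair_big; apply: card_covered.
have cM2 : #|M2| <= mixed F B A.
  by rewrite /mixed pair_big; apply: card_covered.
have cM3 : #|M3| <= crossing F A B.
  rewrite /crossing /slice; under eq_bigr do rewrite pair_big.
  by rewrite pair_big; apply: card_covered.
apply: leq_trans (subset_leq_card sF) _.
have U4 (S1 S2 : {set {set T}}) : #|S1 :|: S2| <= #|S1| + #|S2|.
  by rewrite cardsU leq_subr.
apply: leq_trans (U4 _ _) (leq_add _ cM3).
apply: leq_trans (U4 _ _) (leq_add _ cM2).
apply: leq_trans (U4 _ _) (leq_add _ cM1).
by rewrite cards2 ltnS leq_b1.
Qed.

(** For fixed a and b, the member b + (A - a) allows only one of its neighbours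
    a + (B - b) and {z, a, c} with c <> b. The weight 2p makes the resulting
    inequality hold also when that set is not in F: there are 2p triples. *)
Lemma mixed_bound F A B p :
    {in F, forall X : {set T}, #|X| = 3} -> dissociated F ->
    A \in F -> B \in F -> [disjoint A & B] -> #|~: (A :|: B)| = p ->
  2 * p * mixed F A B + mixed F B A + 2 * crossing F A B <= 9 * (2 * p + 1).
Proof.
move=> cF dF AF BF dAB cZ.
have row a b : a \in A -> b \in B ->
    2 * p * (b |: (A :\ a) \in F) + (a |: (B :\ b) \in F) +
    \sum_(z in ~: (A :|: B)) \sum_(c in B | c != b) (z |: [set a; c] \in F)
    <= 2 * p + 1.
  move=> aA bB; have bA : b \notin A by rewrite (disjointFl dAB).
  have aB : a \notin B by rewrite (disjointFr dAB).
  have [S1F|_] := boolP (b |: (A :\ a) \in F); last first.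
    rewrite muln0 add0n addnC leq_add ?leq_b1 //.
    rewrite mulnC -cZ -sum_nat_const; apply: leq_sum => z _.
    apply: (@leq_trans (\sum_(c in B | c != b) 1)).
      by apply: leq_sum => c _; apply: leq_b1.
    rewrite (eq_bigl (mem (B :\ b))) => [|c]; last by rewrite !inE andbC.
    by rewrite sum1_card -ltnS -(cF _ BF) [#|B|](cardsD1 b) bB.
  have dis z c : z \in ~: (A :|: B) -> c \in B -> c != b ->
      [disjoint b |: (A :\ a) & z |: [set a; c]].
    move=> /setCP/negP; rewrite in_setU negb_or => /andP[zA zB] cB cb.
    rewrite disjoint_triple !inE (negPf zA) (negPf cb) eqxx (disjointFl dAB cB).
    by rewrite !andbF !orbF (contraNneq _ zB) ?(contraNneq _ aB) // => ->.
  rewrite muln1 -addnA leq_add2l pair_big /=.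
  have [S2F|_] := boolP (a |: (B :\ b) \in F); last first.
    rewrite add0n; apply: sum_bool_le1 => -[z c] [z' c'] /=.
    move=> /and3P[zZ cB cb] /and3P[z'Z c'B c'b] XF YF.
    have := dF _ _ _ S1F XF YF (dis _ _ zZ cB cb) (dis _ _ z'Z c'B c'b).
    by case/(triple_inj dAB); rewrite -?in_setC // => -> _ ->.
  rewrite big1 // => -[z c] /= /and3P[zZ cB cb]; apply/eqP; rewrite eqb0.
  have dS : [disjoint b |: A :\ a & a |: B :\ b].
    rewrite disjointsU1 !inE eqxx /= orbF; apply/andP; split.
      by apply: contraNneq aB => <-.
    apply/pred0P=> x /=; rewrite !inE; have [->|_] //= := eqVneq x a.
    by have [xA|//] := boolP (x \in A); rewrite (disjointFr dAB xA) andbF.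
  apply/negP=> XF; have eX := dF _ _ _ S1F S2F XF dS (dis _ _ zZ cB cb).
  have: z \in a |: (B :\ b) by rewrite eX !inE eqxx.
  move: zZ; rewrite !inE negb_or => /andP[zA /negPf->].
  by rewrite andbF orbF (negPf (contraNneq _ zA)) => // ->.
have cols a : a \in A ->
    2 * p * (\sum_(b in B) (b |: (A :\ a) \in F)) +
    \sum_(b in B) (a |: (B :\ b) \in F) +
    2 * \sum_(z in ~: (A :|: B)) \sum_(b in B) (z |: [set a; b] \in F)
    <= 3 * (2 * p + 1).
  move=> aA; rewrite -(cF _ BF) -sum_nat_const.
  apply: leq_trans (leq_sum _ (fun b bB => row a b aA bB)).
  rewrite !big_split /= big_distrr leq_add2l.
  rewrite big_distrr exchange_big /=; apply: leq_sum => z _.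
  by rewrite sum_others (cF _ BF).
rewrite (_ : 9 * _ = 3 * (3 * (2 * p + 1))); last by lia.
rewrite -[X in X * (3 * _)](cF _ AF) -sum_nat_const.
apply: leq_trans (leq_sum _ cols); rewrite 2!big_split /= -!big_distrr /=.
rewrite /mixed [X in _ + X + _ <= _]exchange_big /=.
by rewrite leq_add2l /crossing [in leqRHS]exchange_big.
Qed.

(** A member {x, a, b} is disjoint from {y, c, d} as soon as c <> a and d <> b,
    so the row counts r x and r y satisfy the hypotheses of
    [cross_rows_le9] in both directions. *)
Lemma slices_bound F A B x y :
    {in F, forall X : {set T}, #|X| = 3} -> dissociated F ->
    A \in F -> B \in F -> [disjoint A & B] ->
    x \notin A :|: B -> y \notin A :|: B -> x != y ->
  slice F A B x + slice F A B y <= 9.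
Proof.
move=> cF dF AF BF dAB.
pose r z a := \sum_(b in B) (z |: [set a; b] \in F).
have r_le3 z a : r z a <= 3.
  by rewrite -(cF _ BF) -sum1_card; apply: leq_sum => b _; apply: leq_b1.
have rows z z' a : z \notin A :|: B -> z' \notin A :|: B -> z != z' -> a \in A ->
    0 < r z a -> \sum_(c in A | c != a) (r z' c).-1 <= 1.
  move=> zAB z'AB zz' aA; rewrite lt0n sum_nat_eq0 => /forallPn[b].
  rewrite negb_imply eqb0 negbK => /andP[bB CF].
  apply: (@leq_trans (\sum_(c in A | c != a) \sum_(d in B | d != b)
      (z' |: [set c; d] \in F))).
    apply: leq_sum => c _; rewrite /r (bigD1 b) //=.
    by case: (_ \in F); rewrite ?add1n ?add0n //= leq_pred.
  rewrite pair_big_dep; apply: sum_bool_le1 => -[c d] [c' d'] /=.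
  move=> /andP[/andP[cA ca] /andP[dB db]] /andP[/andP[c'A c'a] /andP[d'B d'b]].
  have dis u v : u \in A -> u != a -> v \in B -> v != b ->
      [disjoint z |: [set a; b] & z' |: [set u; v]].
    move: zAB z'AB; rewrite !inE !negb_or => /andP[zA zB] /andP[z'A z'B].
    move=> uA ua vB vb; rewrite disjoint_triple !inE (eq_sym z') (negPf zz').
    rewrite (negPf ua) (negPf vb) !orbF /=.
    have ne (S : {set T}) s t : s \in S -> t \notin S -> (s == t) = false.
      by move=> sS; apply: contraNF => /eqP <-.
    rewrite !(eq_sym z') (ne A a) // (ne B b) // (ne A u z) // (ne B v z) //.
    by rewrite (ne A u b) ?(ne B v a) ?(disjointFl dAB bB) ?(disjointFr dAB aA).
  move=> XF YF.
  have := dF _ _ _ CF XF YF (dis _ _ cA ca dB db) (dis _ _ c'A c'a d'B d'b).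
  by case/(triple_inj dAB) => // _ -> ->.
move=> xAB yAB xy.
have [a0 [a1 [a2 [a01 a02 a12 defA]]]] : exists a0 a1 a2,
    [/\ a0 != a1, a0 != a2, a1 != a2 & A = a0 |: [set a1; a2]].
  have [a0 a0A] : exists a0, a0 \in A.
    by apply/set0Pn; rewrite -card_gt0 (cF _ AF).
  have /cards2P[a1 [a2 [a12 e]]] : #|A :\ a0| == 2.
    by rewrite -eqSS -(cF _ AF) [#|A|](cardsD1 a0) a0A.
  have := set21 a1 a2; have := set22 a1 a2; rewrite -e !inE.
  move=> /andP[a20 _] /andP[a10 _].
  by exists a0, a1, a2; rewrite -e setD1K // ![a0 == _]eq_sym.
have sumA f (P : pred T) : \sum_(a in A | P a) f a =
    (if P a0 then f a0 else 0) + (if P a1 then f a1 else 0) +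
    (if P a2 then f a2 else 0).
  rewrite big_mkcondr defA !big_setU1 ?big_set1 ?inE ?negb_or ?a01 //=.
  by rewrite addnA.
have sliceE z : slice F A B z = r z a0 + r z a1 + r z a2.
  by rewrite /slice -(sumA (r z) xpredT) big_mkcondr.
have [A0 A1 A2] : [/\ a0 \in A, a1 \in A & a2 \in A].
  by rewrite defA !inE !eqxx !orbT.
have others z z' : z \notin A :|: B -> z' \notin A :|: B -> z != z' ->
  [/\ 0 < r z a0 -> (r z' a1).-1 + (r z' a2).-1 <= 1,
      0 < r z a1 -> (r z' a0).-1 + (r z' a2).-1 <= 1 &
      0 < r z a2 -> (r z' a0).-1 + (r z' a1).-1 <= 1].
  move=> zAB z'AB zz'.
  by split=> /(rows _ _ _ zAB z'AB zz'); rewrite sumA !eqxx /=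
    ?(eq_sym a1 a0) ?(eq_sym a2 a0) ?(eq_sym a2 a1) ?a01 ?a02 ?a12 ?add0n ?addn0;
    apply.
have yx : y != x by rewrite eq_sym.
by rewrite !sliceE; apply: cross_rows_le9 (others x y _ _ _) (others y x _ _ _).
Qed.
End Triples.

(** * The bound for dissociated families *)

(** Sum [slices_bound] over the ordered pairs of distinct points outside. *)
Lemma crossing_bound (T : finType) (F : {set {set T}}) (A B : {set T}) p :
    {in F, forall X : {set T}, #|X| = 3} -> dissociated F ->
    A \in F -> B \in F -> [disjoint A & B] -> #|~: (A :|: B)| = p -> 2 <= p ->
  2 * crossing F A B <= 9 * p.
Proof.
move=> cF dF AF BF dAB cZ p2; set Z := ~: _ in cZ.
have pairs : \sum_(x in Z) \sum_(y in Z | y != x) (slice F A B x + slice F A B y)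
    <= \sum_(x in Z) p.-1 * 9.
  apply: leq_sum => x xZ; rewrite -cZ (cardsD1 x) xZ -sum_nat_const.
  rewrite (eq_bigl (mem (Z :\ x))) => [|y]; last by rewrite !inE andbC.
  apply: leq_sum => y; rewrite !inE => /andP[yx yAB].
  by apply: slices_bound => //; rewrite ?inE // 1?eq_sym //; move: xZ; rewrite !inE.
move: pairs; rewrite sum_nat_const cZ.
under eq_bigr do rewrite big_split.
rewrite big_split /= sum_others cZ.
have -> : \sum_(x in Z) \sum_(y in Z | y != x) slice F A B x = p.-1 * crossing F A B.
  rewrite /crossing big_distrr; apply: eq_bigr => x xZ /=.
  rewrite (eq_bigl (mem (Z :\ x))) => [|y]; last by rewrite !inE andbC.
  by rewrite sum_nat_const -cZ (cardsD1 x Z) xZ.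
rewrite -/(crossing F A B); nia.
Qed.

(** With S = I + J + G, adding the first two bounds and using the third gives
    2 (2p + 1) S <= 36 (2p + 1) + 9p (2p - 3). If S were at least N - 1, this
    would yield 2 p^3 + p^2 <= 18, which fails from p = 2 on. *)
Lemma counting_arithmetic p I J G N : 2 <= p ->
    2 * p * I + J + 2 * G <= 9 * (2 * p + 1) ->
    2 * p * J + I + 2 * G <= 9 * (2 * p + 1) ->
    2 * G <= 9 * p -> 2 * N = (p + 5) * (p + 4) ->
  2 + I + J + G <= N.
Proof.
case: p => [|[|q]] // _ mixI mixJ cross bin.
have cross' : (2 * q + 1) * (2 * G) <= (2 * q + 1) * (9 * q.+2).
  by rewrite leq_pmul2l // addn1.
rewrite leqNgt; apply/negP => lt_N.
have lt_N' : (2 * q.+2 + 1) * (2 * N) <= (2 * q.+2 + 1) * (2 * (I + J + G + 1)).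
  by rewrite leq_pmul2l; lia.
rewrite bin in lt_N'.
lia.
Qed.

Theorem card_dissociated n (F : {set {set 'I_n}}) : 8 <= n ->
    {in F, forall X : {set 'I_n}, #|X| = 3} -> dissociated F ->
  #|F| <= 'C(n.-1, 2).
Proof.
move=> n8 cF dF.
have [/existsP[A /existsP[B /and3P[AF BF dAB]]]|noedge] :=
    boolP [exists A, exists B, [&& A \in F, B \in F & [disjoint A & B]]]; last first.
  apply: (@erdos_ko_rado n 3) => //; first by lia.
  move=> X Y XF YF; apply: contraNN noedge => dXY.
  by apply/existsP; exists X; apply/existsP; exists Y; rewrite XF YF.
have cZ : #|~: (A :|: B)| = n - 6.
  by rewrite cardsCs setCK cardsU disjoint_setI0 // cards0 !cF // card_ord subn0.
have dBA : [disjoint B & A] by rewrite disjoint_sym.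
have cover := card_le_mixed_crossing cF dF AF BF dAB.
have p2 : 2 <= n - 6 by lia.
have cross := crossing_bound cF dF AF BF dAB cZ p2.
have mixAB := mixed_bound cF dF AF BF dAB cZ.
have cZ' : #|~: (B :|: A)| = n - 6 by rewrite setUC.
have mixBA := mixed_bound cF dF BF AF dBA cZ'.
rewrite crossingC in mixBA.
apply: leq_trans cover _.
have bin : 2 * 'C(n.-1, 2) = (n - 6 + 5) * (n - 6 + 4).
  by rewrite -mul_bin_diag bin1; congr (_ * _); lia.
exact: counting_arithmetic p2 mixAB mixBA cross bin.
Qed.

(** * Dissociation and independence numbers of Kneser graphs *)

Section Graphs.
Variables (T : finType) (e : rel T).

Lemma dissociation_setP (D : {set T}) :
  reflect {in D & &, forall x y z, e x y -> e x z -> y = z} (dissociation_set e D).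
Proof.
apply: (iffP (bigmax_leqP _ _ _)) => [deg x y z xD yD zD exy exz | dis x _].
  have /card_le1_eqP/(_ (Sub y yD) (Sub z zD)) := deg (Sub x xD) isT.
  by rewrite !inE /induced !SubK => /(_ exy exz) /(congr1 val); rewrite !SubK.
apply/card_le1_eqP=> y z; rewrite !inE => exy exz; apply: val_inj.
exact: (dis _ _ _ (valP x) (valP z) (valP y) exz exy).
Qed.

Lemma alpha_le_diss : irreflexive e -> alpha e <= diss e.
Proof.
move=> irr; apply/bigmax_leqP => S indS; apply: leq_bigmax_cond.
apply/dissociation_setP => x y z xS yS _ exy.
have /forall_inP/(_ x xS)/forall_inP/(_ y yS) := indS.
by rewrite exy; case: eqVneq exy => // ->; rewrite irr.
Qed.
End Graphs.

Section Kneser.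
Variable n : nat.

Lemma card_vertices_val k (D : {set kneser_vertex n k}) : #|val @: D| = #|D|.
Proof. exact: card_imset val_inj. Qed.

Lemma vertices_val_card k (D : {set kneser_vertex n k}) :
  {in val @: D, forall X : {set 'I_n}, #|X| = k}.
Proof. by move=> _ /imsetP[X _ ->]; apply/eqP/(valP X). Qed.

(** Transfers a uniform family of sets to a set of vertices of the graph. *)
Lemma vertices_of k (F : {set {set 'I_n}}) :
    {in F, forall X : {set 'I_n}, #|X| = k} ->
  exists2 D : {set kneser_vertex n k}, #|D| = #|F| & {in D, forall x, val x \in F}.
Proof.
move=> cF; exists [set x | val x \in F]; last by move=> x; rewrite inE.
rewrite -card_vertices_val; apply: eq_card => X; apply/imsetP/idP.
  by case=> x + ->; rewrite inE.
move=> XF; have cX : #|X| == k by rewrite cF.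
by exists (Sub X cX); rewrite ?inE.
Qed.

Lemma subsetC1 (v : 'I_n) (X : {set 'I_n}) : (X \subset ~: [set v]) = (v \notin X).
Proof. by rewrite subsets_disjoint setCK disjoint_sym disjoints1. Qed.

(** The k-sets through a fixed point v0 meet pairwise. *)
Lemma alpha_star k : 0 < k -> 0 < n -> 'C(n.-1, k.-1) <= alpha (kneser n k).
Proof.
case: k => // k _ /prednK en; have v0 : 'I_n by rewrite -en; exact: ord0.
pose F := [set v0 |: X |
  X in [set X : {set 'I_n} | X \subset ~: [set v0] & #|X| == k]].
have inF X : X \in F -> v0 \in X /\ #|X| = k.+1.
  case/imsetP=> Y; rewrite inE subsetC1 => /andP[vY /eqP cY] ->.
  by rewrite setU11 cardsU1 vY cY.
have [|D cD DF] := @vertices_of k.+1 F; first by move=> X /inF[].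
have <- : #|D| = 'C(n.-1, k).
  rewrite cD card_in_imset ?cards_draws ?cardsC1 ?card_ord //.
  move=> X Y; rewrite !inE !subsetC1 => /andP[vX _] /andP[vY _] eXY.
  by rewrite -(setU1K vX) eXY setU1K.
apply: leq_bigmax_cond; apply/forall_inP=> x xD; apply/forall_inP=> y yD.
apply/implyP=> _; rewrite /kneser -setI_eq0; apply/set0Pn; exists v0.
by rewrite inE (inF _ (DF _ xD)).1 (inF _ (DF _ yD)).1.
Qed.

Lemma alpha_le k : 0 < k -> 2 * k <= n -> alpha (kneser n k) <= 'C(n.-1, k.-1).
Proof.
move=> k_gt0 le_2k; apply/bigmax_leqP => S indS; rewrite -card_vertices_val.
apply: erdos_ko_rado => //; first exact: vertices_val_card.
move=> _ _ /imsetP[x xS ->] /imsetP[y yS ->].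
have /forall_inP/(_ x xS)/forall_inP/(_ y yS) := indS.
case: eqVneq => //= -> _; have := kneser_irrefl k_gt0 y.
by rewrite /kneser => ->.
Qed.

(** Inside a set of 2k points, a k-set is disjoint only from its complement. *)
Lemma diss_ge k : 2 * k <= n -> 'C(2 * k, k) <= diss (kneser n k).
Proof.
move=> le_2k.
have [Y cY] : exists Y : {set 'I_n}, #|Y| = 2 * k.
  have: 0 < #|[set Y : {set 'I_n} | #|Y| == 2 * k]|.
    by rewrite card_draws card_ord bin_gt0.
  by case/card_gt0P=> Y; rewrite inE => /eqP; exists Y.
pose F := [set X : {set 'I_n} | X \subset Y & #|X| == k].
have [|D cD DF] := @vertices_of k F; first by move=> X; rewrite inE => /andP[_ /eqP].
rewrite -cY -cards_draws -cD; apply: leq_bigmax_cond.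
have compl x y : x \in D -> y \in D -> kneser n k x y -> val y = Y :\: val x.
  move=> /DF; rewrite inE => /andP[xY /eqP cx] /DF; rewrite inE => /andP[yY /eqP cy].
  move=> dxy; have dyx : [disjoint val y & val x] by rewrite disjoint_sym.
  apply/eqP; rewrite eqEcard subsetD yY dyx /=.
  by rewrite cardsD (setIidPr xY) cY cx cy; lia.
apply/dissociation_setP => x y z xD yD zD exy exz; apply: val_inj.
by rewrite (compl x y) // (compl x z).
Qed.

Lemma diss3_le : 8 <= n -> diss (kneser n 3) <= 'C(n.-1, 2).
Proof.
move=> n8; apply/bigmax_leqP => D /dissociation_setP disD.
rewrite -card_vertices_val; apply: card_dissociated => //.
  exact: vertices_val_card.
move=> _ _ _ /imsetP[x xD ->] /imsetP[y yD ->] /imsetP[z zD ->] exy exz.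
by rewrite (disD x y z).
Qed.
End Kneser.

Theorem corollary2p6 (n : nat) (hn : 6 <= n) :
  diss (kneser n 3) = alpha (kneser n 3) <-> 8 <= n.
Proof.
split=> [eq_da | n8]; last first.
  apply/eqP; rewrite eqn_leq alpha_le_diss ?andbT; last exact: kneser_irrefl.
  by apply: leq_trans (diss3_le n8) _; apply: (alpha_star (k := 3)); lia.
rewrite leqNgt; apply/negP => n_lt8.
have := leq_trans (diss_ge (k := 3) hn) _; rewrite eq_da.
move/(_ _ (alpha_le (k := 3) isT hn)).
(* The inequality C(6, 3) <= C(n-1, 2) now fails for n = 6 and n = 7. *)
by move: hn n_lt8 {eq_da}; case: n => [|[|[|[|[|[|[|[|]]]]]]]].
Qed.
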